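(* Let $n\ge 2$ be an integer. Let $\mathfrak{A}$ and $\mathfrak{A}'$ be prime $C^*$-algebras with identities $I_{\mathfrak{A}}$ and $I_{\mathfrak{A}'}$, respectively, and let $P_1$ and $P_2=I_{\mathfrak{A}}-P_1$ be nontrivial projections in $\mathfrak{A}$. Then a map $\varphi:\mathfrak{A}\to\mathfrak{A}'$ is a bijective unital multiplicative $*$-Jordan $n$-map if and only if $\varphi$ is a $*$-ring isomorphism.
   Context: $C^*$-algebras are complex. A $C^*$-algebra $\mathfrak{A}$ is prime if, for $A,B\in\mathfrak{A}$, $A\mathfrak{A}B=\{0\}$ implies $A=0$ or $B=0$. For elements $A,B$ of a $*$-ring, $\{A,B\}_*:=AB+BA^*$ (the $*$-Jordan product). Define $q_{1*}(x)=x$ and $q_{n*}(x_1,\dots,x_n)=\{q_{(n-1)*}(x_1,\dots,x_{n-1}),x_n\}_*$ for $n\ge 2$. A map $\varphi$ (not necessarily additive) is a multiplicative $*$-Jordan $n$-map if $\varphi(q_{n*}(x_1,\dots,x_n))=q_{n*}(\varphi(x_1),\dots,\varphi(x_n))$ for all $x_1,\dots,x_n$. A projection is a self-adjoint idempotent; it is nontrivial if it is neither $0$ nor the identity. Unital means $\varphi(I_{\mathfrak{A}})=I_{\mathfrak{A}'}$. A $*$-ring isomorphism is a bijective map that is additive, multiplicative and satisfies $\varphi(A^* )=\varphi(A)^*$ (complex linearity is not required). *)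

(* Defs.v *)
From HB Require Import structures.
From mathcomp Require Import all_boot all_order all_algebra.
From mathcomp Require Import all_classical all_reals all_analysis.
From mathcomp Require Import complex.

Set Implicit Arguments.
Unset Strict Implicit.
Unset Printing Implicit Defensive.

Import Order.TTheory GRing.Theory Num.Theory.
Import numFieldNormedType.Exports.

Local Open Scope ring_scope.
Local Open Scope complex_scope.

HB.mixin Record NzRing_isStarRing A & GRing.NzRing A := {
  star : A -> A;
  starK : involutive star;
  starD : {morph star : x y / x + y};
  starM : forall x y : A, star (x * y) = star y * star x
}.

#[short(type="starRingType")]
HB.structure Definition StarRing := {A of GRing.NzRing A & NzRing_isStarRing A}.

(* Unital complex C*-algebras. The Hierarchy Builder refuses a common extension
   of GRing.NzRing and NormedModule (their join is missing below Num.NumDomain),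
   so the norm is introduced here; the completeNormedModType structure that it
   determines is derived below. Following normedModType, the norm takes its
   values in R[i]: the first three axioms force them to be nonnegative, hence
   real. [cstar_complete] is [cauchy_cvg] for the uniformity of the norm.
   The ring structure requires 1 != 0. *)
HB.mixin Record isCStarAlgebra (R : realType) A
    & GRing.Algebra R[i] A & StarRing A := {
  starZ : forall (c : R[i]) (x : A), star (c *: x) = c^* *: star x;
  cstar_norm : A -> R[i];
  cstar_normD : forall x y : A,
    cstar_norm (x + y) <= cstar_norm x + cstar_norm y;
  cstar_normZ : forall (c : R[i]) (x : A),
    cstar_norm (c *: x) = `|c| * cstar_norm x;
  cstar_norm_eq0 : forall x : A, cstar_norm x = 0 -> x = 0;
  cstar_complete : forall F : set_system A, ProperFilter F ->
    (forall e : R[i], 0 < e -> exists x : A, F (ball_ cstar_norm x e)) ->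
    exists l : A, forall e : R[i], 0 < e -> F (ball_ cstar_norm l e);
  cstar_normM : forall x y : A,
    cstar_norm (x * y) <= cstar_norm x * cstar_norm y;
  cstar_norm_star : forall x : A, cstar_norm (star x * x) = cstar_norm x ^+ 2
}.

#[short(type="cstarAlgType")]
HB.structure Definition CStarAlgebra (R : realType) :=
  {A of GRing.Algebra R[i] A & StarRing A & isCStarAlgebra R A}.

Section CompleteNormed.
Variables (R : realType) (A : cstarAlgType R).

#[non_forgetful_inheritance]
HB.instance Definition _ := Lmodule_isNormed.Build R[i] A
  (@cstar_normD R A) (@cstar_normZ R A) (@cstar_norm_eq0 R A).

Lemma cstar_normE (x : A) : `|x| = cstar_norm x.
Proof. by []. Qed.

Lemma cstar_cauchy_cvg (F : set_system A) :
  ProperFilter F -> cauchy F -> cvg F.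
Proof.
move=> FF /cauchyP Fc.
have [|l Fl] := @cstar_complete R A F FF.
  by move=> e e0; have [x Fx] := Fc e e0; exists x; move: Fx; rewrite -ball_normE.
apply/cvg_ex; exists l; apply/cvg_ballP => e e0.
by have := Fl e e0; rewrite -ball_normE.
Qed.

#[non_forgetful_inheritance]
HB.instance Definition _ := Uniform_isComplete.Build A cstar_cauchy_cvg.

End CompleteNormed.

Definition prime_ring (A : nzRingType) : Prop :=
  forall a b : A, (forall x : A, a * x * b = 0) -> a = 0 \/ b = 0.

Section StarRings.
Context {A : starRingType}.
Implicit Types (x y p : A) (s : seq A).

Definition projection p : Prop := star p = p /\ p * p = p.

Definition nontrivial_projection p : Prop :=
  [/\ projection p, p <> 0 & p <> 1].

Definition star_jordan x y : A := x * y + y * star x.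

(* q_{n*}(x_1, ..., x_n) is [star_jordan_n [:: x_1; ...; x_n]]; the value on
   the empty sequence is junk. *)
Definition star_jordan_n s : A :=
  if s is x :: s' then foldl star_jordan x s' else 0.

Lemma star_jordan_n1 x : star_jordan_n [:: x] = x.
Proof. by []. Qed.

Lemma star_jordan_n_rcons s y : (0 < size s)%N ->
  star_jordan_n (rcons s y) = star_jordan (star_jordan_n s) y.
Proof. by case: s => //= x s _; rewrite foldl_rcons. Qed.

End StarRings.

Definition multiplicative_star_jordan (A B : starRingType) (n : nat)
    (phi : A -> B) : Prop :=
  forall x : n.-tuple A, phi (star_jordan_n x) = star_jordan_n (map phi x).

Definition star_ring_isomorphism (A B : starRingType) (phi : A -> B) : Prop :=
  [/\ bijective phi,
      {morph phi : x y / x + y},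
      {morph phi : x y / x * y}
    & {morph phi : x / star x}].

(* Main.v *)
Require Import Defs.
From mathcomp Require Import all_boot all_order all_algebra.
From mathcomp Require Import all_classical all_reals all_analysis.
From mathcomp Require Import complex.

Set Implicit Arguments.
Unset Strict Implicit.
Unset Printing Implicit Defensive.

Import GRing.Theory Num.Theory.

Local Open Scope ring_scope.

(** The proof is algebraic. An isomorphism preserves whatever is built from the
    ring operations and [star]. For the converse, the scalars [1 / 2] and [i]
    are used as elements of the ring: [i] is central, skew and squares to -1.

    Feeding ones into the first [n - 2] slots of the [n]-fold product gives
    [{x, y} *+ 2 ^ (n - 2)], and feeding a further one shows that [phi] commutes
    with multiplication by [2 ^ (n - 1)]. Dividing the two, [phi] preserves the
    normalized binary product [{x, y} / 2], whatever [n] is.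

    Additivity. Suppose [phi t = phi a + phi b], where [t] exists by
    surjectivity. For every [z], injectivity turns
    [{phi z, phi t} = {phi z, phi a} + {phi z, phi b}] into
    [{z, t} = {z, a} + {z, b}], as soon as [phi] is known to be additive at the
    halves of the two terms on the right, for instance because one of them
    vanishes ([additive_transfer_r]). Testing with [z] built from the projections
    [p] and [q = 1 - p] then forces [t = a + b]. This gives additivity between
    different Peirce components ([additive_corners_off], [additive_diag_off],
    [additive_peirce]). Within an off-diagonal corner it comes from expanding
    [{p + a, q + b}] ([additive_corner]), and within a diagonal one from testing
    with off-diagonal elements, which detect everything since the ring is prime
    ([additive_diag]).

    Multiplicativity. Once additive, [phi] preserves [star] (take [y = 1]) and
    the Jordan products by self-adjoint elements. The image [J] of [i] is central
    and skew, and [{i s, x} = i [s, x]] for self-adjoint [s] shows that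
    [phi (i [s, x]) = J [phi s, phi x]]. A double commutator with a projection
    fixes the off-diagonal elements, so computing [phi (i [p, i [p, t]])] for
    such a self-adjoint [t] yields [(J ^ 2 + 1) * phi t = 0]; as the target is
    prime, [J ^ 2 = -1]. So [phi] also preserves commutators with self-adjoint
    elements, hence products by them, and it intertwines [i] and [J], hence it
    preserves all products. *)

(** * The star-Jordan product *)

Section StarRingTheory.
Context {A : starRingType}.
Implicit Types x y z : A.

Lemma star0 : star (0 : A) = 0.
Proof. by apply: (@addrI _ (star 0)); rewrite -starD !addr0. Qed.

Lemma starN x : star (- x) = - star x.
Proof. by apply: (@addrI _ (star x)); rewrite -starD !subrr star0. Qed.

Lemma starB x y : star (x - y) = star x - star y.
Proof. by rewrite starD starN. Qed.

Lemma star1 : star (1 : A) = 1.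
Proof. by rewrite -[star 1]mulr1 -{2}(starK 1) -starM mulr1 starK. Qed.

Lemma star_natmul x n : star (x *+ n) = star x *+ n.
Proof. by elim: n => [|n IHn]; rewrite ?star0// !mulrS starD IHn. Qed.

Lemma star_jordanDl x y z :
  star_jordan (x + y) z = star_jordan x z + star_jordan y z.
Proof. by rewrite /star_jordan starD mulrDl mulrDr addrACA. Qed.

Lemma star_jordanDr x y z :
  star_jordan x (y + z) = star_jordan x y + star_jordan x z.
Proof. by rewrite /star_jordan mulrDl mulrDr addrACA. Qed.

Lemma star_jordan0l x : star_jordan 0 x = 0.
Proof. by rewrite /star_jordan star0 mul0r mulr0 addr0. Qed.

Lemma star_jordan0r x : star_jordan x 0 = 0.
Proof. by rewrite /star_jordan mul0r mulr0 addr0. Qed.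

Lemma star_jordan1l x : star_jordan 1 x = x *+ 2.
Proof. by rewrite /star_jordan star1 mul1r mulr1. Qed.

Lemma star_jordanNl x y : star_jordan (- x) y = - star_jordan x y.
Proof. by rewrite /star_jordan starN mulNr mulrN opprD. Qed.

Lemma star_jordan_sa x y : star x = x -> star_jordan x y = x * y + y * x.
Proof. by rewrite /star_jordan => ->. Qed.

Lemma star_jordan_natl x y n : star_jordan (x *+ n) y = star_jordan x y *+ n.
Proof. by rewrite /star_jordan star_natmul mulrnAl mulrnAr mulrnDl. Qed.

Lemma foldl_star_jordan1 m k :
  foldl star_jordan (1 *+ k) (nseq m 1) = 1 *+ (k * 2 ^ m) :> A.
Proof.
elim: m k => [|m IHm] k /=; first by rewrite muln1.
by rewrite star_jordan_natl star_jordan1l -mulrnA IHm expnS mulnA (mulnC k).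
Qed.

Lemma star_jordan_n_nseq1 m x y :
  star_jordan_n (nseq m 1 ++ [:: x; y]) = star_jordan x y *+ 2 ^ m.
Proof.
case: m => [|m] //; rewrite /= foldl_cat.
have -> : foldl star_jordan 1 (nseq m 1) = 1 *+ 2 ^ m :> A.
  by have := foldl_star_jordan1 m 1; rewrite mul1n.
by rewrite /= !star_jordan_natl star_jordan1l star_jordan_natl -mulrnA -expnS.
Qed.

End StarRingTheory.

(** * Peirce components *)

(** The Peirce corner [e A f], and the off-diagonal part [p A q + q A p] for
    [q = 1 - p]: both are cut out by linear equations, so that no explicit
    decomposition has to be carried along. *)
Definition corner (A : nzRingType) (e f x : A) : Prop := e * x = x /\ x * f = x.

Definition off_diagonal (A : nzRingType) (p x : A) : Prop := p * x + x * p = x.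

Definition complementary (A : starRingType) (p q : A) : Prop :=
  projection p /\ q = 1 - p.

Lemma double0_inj (V : zmodType) : (forall x : V, x *+ 2 = 0 -> x = 0) ->
  forall x y : V, x *+ 2 = y *+ 2 -> x = y.
Proof.
move=> double0 x y e; apply/eqP; rewrite -subr_eq0; apply/eqP/double0.
by rewrite mulrnBl e subrr.
Qed.

Section Peirce.
Context {A : starRingType} (half : A).
Hypothesis half2 : half *+ 2 = 1.
Implicit Types p q x y : A.

Lemma half_double x : half * (x *+ 2) = x.
Proof. by rewrite mulrnAr -mulrnAl half2 mul1r. Qed.

Lemma double_half x : (half * x) *+ 2 = x.
Proof. by rewrite -mulrnAl half2 mul1r. Qed.

Lemma double_inj x y : x *+ 2 = y *+ 2 -> x = y.
Proof. by move=> /(congr1 ( *%R half)); rewrite !half_double. Qed.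

Lemma half_comm x : half * x = x * half.
Proof.
by rewrite -[RHS]double_half -!mulrnAr half2 mulr1.
Qed.

Lemma corner_half p q x : corner p q x -> corner p q (half * x).
Proof. by case=> px xq; split; rewrite ?mulrA -?half_comm -!mulrA ?px ?xq. Qed.

Lemma off_half p x : off_diagonal p x -> off_diagonal p (half * x).
Proof.
by move=> ox; rewrite /off_diagonal mulrA -half_comm -!mulrA -mulrDr ox.
Qed.

Lemma cornerD p q x y :
  corner p q x -> corner p q y -> corner p q (x + y).
Proof.
by move=> [px xq] [py yq]; split; rewrite ?mulrDr ?mulrDl ?px ?py ?xq ?yq.
Qed.

Lemma offD p x y :
  off_diagonal p x -> off_diagonal p y -> off_diagonal p (x + y).
Proof. by move=> ox oy; rewrite /off_diagonal mulrDl mulrDr addrACA ox oy. Qed.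

Lemma complementaryC p q : complementary p q -> complementary q p.
Proof.
case=> -[sp pp] ->; split; last by rewrite subKr.
by split; rewrite ?starB ?star1 ?sp// mulrBl mul1r mulrBr mulr1 pp subrr subr0.
Qed.

Section ComplementaryPair.
Variables p q : A.
Hypothesis pq1 : complementary p q.

Lemma compl_sum : p + q = 1.
Proof. by case: pq1 => _ ->; rewrite addrC subrK. Qed.

Lemma compl_idem : p * p = p.
Proof. by case: pq1 => -[]. Qed.

Lemma compl_star : star p = p.
Proof. by case: pq1 => -[]. Qed.

Lemma compl_mul0 : p * q = 0.
Proof. by case: pq1 => -[_ pp] ->; rewrite mulrBr mulr1 pp subrr. Qed.

Lemma corner_compl_l f x : corner p f x -> q * x = 0.
Proof.
case=> <- _; case: pq1 => -[_ pp] ->.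
by rewrite mulrA mulrBl mul1r pp subrr mul0r.
Qed.

Lemma corner_compl_r f x : corner f p x -> x * q = 0.
Proof. by case=> _ <-; rewrite -mulrA compl_mul0 mulr0. Qed.

(** Since [p * x + x * p] and [q * x + x * q] add up to [x *+ 2]. *)
Lemma off_compl x : off_diagonal p x -> off_diagonal q x.
Proof.
rewrite /off_diagonal => ox; case: pq1 => _ ->.
by rewrite mulrBl mulrBr mul1r mulr1 addrACA -opprD ox addrK.
Qed.

End ComplementaryPair.

Lemma corner_off p q x : complementary p q -> corner p q x -> off_diagonal p x.
Proof.
move=> pq cx; rewrite /off_diagonal (corner_compl_r (complementaryC pq) cx).
by case: cx => -> _; rewrite addr0.
Qed.

Lemma off_mul_r p q x : complementary p q -> off_diagonal p x -> x * p = q * x.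
Proof.
by case=> _ -> ox; rewrite mulrBl mul1r -{2}ox [p * x + _]addrC addrK.
Qed.

Lemma corner_off_l p q x :
  complementary p q -> off_diagonal p x -> corner p q (p * x).
Proof.
move=> pq ox; have qp := complementaryC pq.
split; first by rewrite mulrA (compl_idem pq).
by rewrite -(off_mul_r qp (off_compl pq ox)) -mulrA (compl_idem qp).
Qed.

Lemma corner_off_r p q x :
  complementary p q -> off_diagonal p x -> corner q p (q * x).
Proof.
by move=> pq ox; apply: corner_off_l (complementaryC pq) (off_compl pq ox).
Qed.

Lemma corner_star p q x :
  star p = p -> star q = q -> corner p q x -> corner q p (star x).
Proof.
move=> sp sq [px xq].
by split; rewrite -[LHS]starK starM starK ?sp ?sq ?px ?xq.
Qed.

(** The corners [p A q] and [q A p] exchanged by [star] are independent. *)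
Lemma corner_sa_inj p q x y : complementary p q -> corner p q x ->
  corner p q y -> x + star x = y + star y -> x = y.
Proof.
move=> pq cx cy /(congr1 ( *%R p)); have qp := complementaryC pq.
have c0 z : corner p q z -> p * star z = 0.
  move=> cz; apply: (corner_compl_l qp (f := p)).
  exact: corner_star (compl_star pq) (compl_star qp) cz.
by rewrite !mulrDr !c0// !addr0; case: cx cy => -> _ [-> _].
Qed.

Lemma peirce_decomposition p q x : complementary p q ->
  x = p * x * p + (p * x * q + q * x * p) + q * x * q.
Proof.
move=> pq; rewrite -{1}[x]mul1r -{1}[1 * x]mulr1 -(compl_sum pq).
by rewrite !mulrDl !mulrDr !addrA.
Qed.

End Peirce.

(** The commutator with [p] is 1 on [p A (1 - p)] and -1 on [(1 - p) A p]. *)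
Lemma double_commutator_off (A : nzRingType) (p x : A) : p * p = p ->
  off_diagonal p x -> p * (p * x - x * p) - (p * x - x * p) * p = x.
Proof.
move=> pp ox; have pxp : p * (x * p) = 0.
  apply: (@addrI _ (p * x)).
  by rewrite addr0 -{3}ox mulrDr [p * (p * x)]mulrA pp.
rewrite mulrBr mulrBl [p * (p * x)]mulrA -!mulrA pp mulrA pp pxp.
by rewrite subr0 sub0r opprK.
Qed.

(** * Additivity *)

Section Additivity.
Variables (A B : starRingType) (half : A) (phi : A -> B).
Hypothesis half2 : half *+ 2 = 1.
Hypothesis double0 : forall x : B, x *+ 2 = 0 -> x = 0.
Hypothesis phi_bij : bijective phi.
(* The factor 2 is put on the side of [B], where no half is assumed. *)
Hypothesis phiJ : forall x y : A,
  phi (half * star_jordan x y) *+ 2 = star_jordan (phi x) (phi y).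
Implicit Types x y z : A.

Let double_injB := double0_inj double0.

Definition additive_at x y : Prop := phi (x + y) = phi x + phi y.

Lemma additive_atC x y : additive_at x y -> additive_at y x.
Proof. by rewrite /additive_at addrC [X in _ -> _ = X]addrC. Qed.

Lemma phi_preim (b : B) : exists x, phi x = b.
Proof. by case: phi_bij => g _ gK; exists (g b); rewrite gK. Qed.

Lemma phi0 : phi 0 = 0.
Proof.
have [b b0] := phi_preim 0.
apply: double0; have := phiJ 0 b.
by rewrite star_jordan0l mulr0 b0 star_jordan0r.
Qed.

Lemma additive_at0l x : additive_at 0 x.
Proof. by rewrite /additive_at phi0 !add0r. Qed.

(** Surjectivity provides a preimage of [phi x + phi y]. *)
Lemma additive_atP x y :
  (forall t, phi t = phi x + phi y -> t = x + y) -> additive_at x y.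
Proof.
move=> xy; have [t te] := phi_preim (phi x + phi y).
by rewrite /additive_at -te (xy t).
Qed.

Lemma phi_half_inj x y : phi (half * x) *+ 2 = phi (half * y) *+ 2 -> x = y.
Proof.
move=> /double_injB /(bij_inj phi_bij) /(congr1 (fun z => z *+ 2)).
by rewrite !double_half.
Qed.

(** The engine of the section: a preimage [t] of [phi a + phi b] is compared
    with [a + b] through its products with test elements [z]. *)
Lemma additive_transfer_r t a b z : phi t = phi a + phi b ->
  additive_at (half * star_jordan z a) (half * star_jordan z b) ->
  star_jordan z t = star_jordan z a + star_jordan z b.
Proof.
move=> e add; apply: phi_half_inj.
by rewrite phiJ e star_jordanDr mulrDr add mulrnDl !phiJ.
Qed.

Lemma additive_transfer_l t a b z : phi t = phi a + phi b ->
  additive_at (half * star_jordan a z) (half * star_jordan b z) ->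
  star_jordan t z = star_jordan a z + star_jordan b z.
Proof.
move=> e add; apply: phi_half_inj.
by rewrite phiJ e star_jordanDl mulrDr add mulrnDl !phiJ.
Qed.

Lemma additive_transfer_r0 t a b z : phi t = phi a + phi b ->
  star_jordan z a = 0 -> star_jordan z t = star_jordan z b.
Proof.
move=> te za; rewrite (additive_transfer_r te) za ?add0r// mulr0.
exact: additive_at0l.
Qed.

Lemma additive_transfer_l0 t a b z : phi t = phi a + phi b ->
  star_jordan a z = 0 -> star_jordan t z = star_jordan b z.
Proof.
move=> te za; rewrite (additive_transfer_l te) za ?add0r// mulr0.
exact: additive_at0l.
Qed.

Lemma star_jordan_compl_sum p q x : complementary p q ->
  star_jordan p x + star_jordan q x = x *+ 2.
Proof. by move=> pq; rewrite -star_jordanDl (compl_sum pq) star_jordan1l. Qed.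

Lemma star_jordan_off p q x :
  complementary p q -> off_diagonal p x -> star_jordan p x = x.
Proof. by move=> pq ox; rewrite star_jordan_sa ?ox // (compl_star pq). Qed.

Lemma star_jordan_diag p q x :
  complementary p q -> corner p p x -> star_jordan p x = x *+ 2.
Proof.
by move=> pq [px xp]; rewrite star_jordan_sa ?px ?xp // (compl_star pq).
Qed.

Lemma star_jordan_diag0 p q x :
  complementary p q -> corner p p x -> star_jordan q x = 0.
Proof.
move=> pq cx; rewrite star_jordan_sa ?(compl_star (complementaryC pq)) //.
by rewrite (corner_compl_l pq cx) (corner_compl_r pq cx) addr0.
Qed.

(** Off-diagonal elements anticommute with [p - q], which makes the latter a
    test element blind to them. *)
Lemma star_jordan_diff_off p q x :
  complementary p q -> off_diagonal p x -> star_jordan (p - q) x = 0.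
Proof.
move=> pq ox; have qp := complementaryC pq.
rewrite star_jordanDl star_jordanNl (star_jordan_off pq ox).
by rewrite (star_jordan_off qp (off_compl pq ox)) subrr.
Qed.

(** The test element [p - q] kills both terms, so a preimage [t] of the sum is
    off-diagonal. With [p] as the second factor, the product is
    [{t, p} = t * p + star (t * p)], which determines [t * p] since the latter
    is in [q A p]. *)
Lemma additive_corners_off p q a b : complementary p q ->
  corner p q a -> corner q p b -> additive_at a b.
Proof.
move=> pq ca cb; have qp := complementaryC pq; apply: additive_atP => t te.
have oa := corner_off pq ca; have ob := off_compl qp (corner_off qp cb).
have ot : off_diagonal p t.
  have : star_jordan (p - q) t = 0.
    by rewrite (additive_transfer_r0 te) (star_jordan_diff_off pq).
  rewrite star_jordanDl star_jordanNl => /subr0_eq pt.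
  have := star_jordan_compl_sum t pq.
  rewrite -pt -mulr2n => /(double_inj half2).
  by rewrite star_jordan_sa ?(compl_star pq).
have tE p' q' c d : complementary p' q' -> off_diagonal p' t ->
    corner q' p' c -> corner p' q' d -> phi t = phi c + phi d -> t * p' = c.
  move=> pq' ot' [qc cp] cd te'; have qp' := complementaryC pq'.
  have sp' := compl_star pq'.
  have ctp : corner q' p' (t * p').
    by rewrite (off_mul_r pq' ot'); apply: corner_off_r.
  apply: (corner_sa_inj qp') => //.
  have sjE y : star_jordan y p' = y * p' + star (y * p').
    by rewrite /star_jordan starM sp'.
  have dp0 : star_jordan d p' = 0.
    by rewrite sjE (corner_compl_r qp' cd) star0 addr0.
  rewrite addrC in te'; have := additive_transfer_l0 te' dp0.
  by rewrite !sjE cp.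
rewrite -[t]mulr1 -(compl_sum qp) mulrDr.
rewrite (tE q p a b)//; last exact: off_compl ot.
by rewrite (tE p q b a)// addrC.
Qed.

(** The test element [q] kills [a] and [p - q] kills [o]; together, since
    [p + q = 1], they determine [t]. *)
Lemma additive_diag_off p q a o : complementary p q ->
  corner p p a -> off_diagonal p o -> additive_at a o.
Proof.
move=> pq ca oo; have qp := complementaryC pq; apply: additive_atP => t te.
have qt : star_jordan q t = o.
  rewrite (additive_transfer_r0 te) ?(star_jordan_diag0 pq ca)//.
  exact: star_jordan_off qp (off_compl pq oo).
have : star_jordan (p - q) t = a *+ 2.
  rewrite addrC in te.
  rewrite (additive_transfer_r0 te) ?(star_jordan_diff_off pq oo)//.
  rewrite star_jordanDl star_jordanNl (star_jordan_diag0 pq ca) subr0.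
  exact: star_jordan_diag pq ca.
rewrite star_jordanDl star_jordanNl qt => /(canRL (subrK _)) pt.
apply: (double_inj half2).
by rewrite -(star_jordan_compl_sum t pq) pt qt mulrnDl -addrA.
Qed.

(** Testing with [p] kills [d]. Testing with [q] kills only [a], but what is
    left is an off-diagonal plus a diagonal term, where additivity is known. *)
Lemma additive_peirce p q a o d : complementary p q ->
  corner p p a -> off_diagonal p o -> corner q q d ->
  phi (a + o + d) = phi a + phi o + phi d.
Proof.
move=> pq ca oo cd; have qp := complementaryC pq.
have oq := off_compl pq oo.
rewrite -(additive_diag_off pq ca oo); apply: additive_atP => t te.
have qao : star_jordan q (a + o) = o.
  rewrite star_jordanDr (star_jordan_diag0 pq ca) (star_jordan_off qp oq).
  exact: add0r.
have qt : star_jordan q t = o + d *+ 2.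
  rewrite (additive_transfer_r te) qao (star_jordan_diag qp cd)//.
  rewrite half_double//; apply/additive_atC/(additive_diag_off qp cd).
  exact: off_half.
have pt : star_jordan p t = a *+ 2 + o.
  rewrite addrC in te.
  rewrite (additive_transfer_r0 te) ?(star_jordan_diag0 qp cd)//.
  by rewrite star_jordanDr (star_jordan_diag pq ca) (star_jordan_off pq oo).
apply: (double_inj half2).
rewrite -(star_jordan_compl_sum t pq) pt qt !mulrnDl.
by rewrite (mulr2n o) !addrA.
Qed.

(** Both [{p + a, q + b}] and its image expand by the additivity already known,
    and the expansion contains [a + b] besides terms in other Peirce components,
    which cancel out. *)
Lemma additive_corner p q a b : complementary p q ->
  corner p q a -> corner p q b -> additive_at a b.
Proof.
move=> pq; have qp := complementaryC pq.
have [sp sq] := (compl_star pq, compl_star qp).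
suff half_add x y : corner p q x -> corner p q y ->
    additive_at (half * x) (half * y).
  move=> ca cb; rewrite -(half_double half2 a) -(half_double half2 b).
  by apply: half_add; rewrite /corner !(mulrnAl, mulrnAr);
    [case: ca => -> -> | case: cb => -> ->].
move=> cx cy; have [[px xq] [py yq]] := (cx, cy).
have csx := corner_star sp sq cx.
have [ox oy] := (corner_off pq cx, corner_off pq cy).
have qy := corner_compl_l pq cy.
have sj_pq : star_jordan p q = 0.
  by rewrite star_jordan_sa // (compl_mul0 pq) (compl_mul0 qp) addr0.
have sj_py : star_jordan p y = y by apply: star_jordan_off pq oy.
have sj_xq : star_jordan x q = x + star x.
  by rewrite /star_jordan xq; case: csx => ->.
have sj_xy : star_jordan x y = y * star x.
  by rewrite /star_jordan -{1}xq -mulrA qy mulr0 add0r.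
have cpp : corner p p p by split; apply: compl_idem pq.
have cqq : corner q q q by split; apply: compl_idem qp.
have cyx : corner p p (y * star x).
  by split; rewrite ?mulrA ?py // -mulrA; case: csx => _ ->.
(* In the expansion, [y] and [x] lie in [p A q], [star x] in [q A p] and
   [y * star x] in [p A p]. *)
have := phiJ (p + x) (q + y).
rewrite (additive_diag_off pq cpp ox).
rewrite (additive_diag_off qp cqq (off_compl pq oy)).
rewrite !star_jordanDl !star_jordanDr -!phiJ -!mulrnDl => /double_injB.
rewrite sj_pq sj_py sj_xq sj_xy !mulr0 phi0 !add0r.
have [hx hy] := (corner_half half2 cx, corner_half half2 cy).
have hsx := corner_half half2 csx.
have -> : half * (y + (x + star x + y * star x)) =
    half * (y * star x) + (half * x + half * y + half * star x).
  rewrite -!mulrDr; congr (_ * _).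
  by rewrite !addrA [y + x]addrC [LHS]addrC !addrA.
have hxy := cornerD hx hy.
rewrite (additive_diag_off pq (corner_half half2 cyx)); last first.
  exact: offD (corner_off pq hxy) (off_compl qp (corner_off qp hsx)).
rewrite (additive_corners_off pq hxy hsx) [in RHS]mulrDr.
rewrite (additive_corners_off pq hx hsx).
rewrite [RHS]addrA [RHS]addrC => /addrI.
by rewrite addrA [phi (half * y) + _]addrC => /addIr.
Qed.

Lemma additive_off p q x y : complementary p q ->
  off_diagonal p x -> off_diagonal p y -> additive_at x y.
Proof.
move=> pq ox oy; have qp := complementaryC pq.
have cl z : off_diagonal p z -> corner p q (p * z) by apply: corner_off_l.
have cr z : off_diagonal p z -> corner q p (q * z) by apply: corner_off_r.
have split_phi z : off_diagonal p z -> phi z = phi (p * z) + phi (q * z).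
  move=> oz; rewrite -(additive_corners_off pq (cl _ oz) (cr _ oz)).
  by rewrite -mulrDl (compl_sum pq) mul1r.
rewrite /additive_at (split_phi _ (offD ox oy)) !mulrDr.
rewrite (additive_corner pq (cl _ ox) (cl _ oy)).
rewrite (additive_corner qp (cr _ ox) (cr _ oy)).
by rewrite addrACA -!split_phi.
Qed.

(** Testing with [q] shows that a preimage [t] of the sum is in [p A]. For [c]
    in [q A p], the products with [c] are off-diagonal, where [phi] is additive,
    so [c * t = c * (a + b)]; such elements [c] separate the points of [p A]. *)
Lemma additive_diag p q a b : complementary p q ->
    (forall d : A, (forall x, q * x * d = 0) -> d = 0) ->
  corner p p a -> corner p p b -> additive_at a b.
Proof.
move=> pq q_faithful ca cb; have qp := complementaryC pq.
apply: additive_atP => t te.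
have [sp sq] := (compl_star pq, compl_star qp).
have qt : q * t = 0.
  have : star_jordan q t = 0.
    by rewrite (additive_transfer_r0 te) (star_jordan_diag0 pq).
  rewrite star_jordan_sa // => qtq.
  have tq : t * q = - (q * t) by apply/eqP; rewrite -addr_eq0 addrC qtq.
  have := congr1 ( *%R q) tq; rewrite mulrN !mulrA (compl_idem qp) => qtq'.
  have tqE : t * q = q * t.
    have := congr1 ( *%R^~ q) tq.
    by rewrite -mulrA (compl_idem qp) mulNr qtq' opprK.
  by apply: (double_inj half2); rewrite mul0rn mulr2n -{2}tqE.
pose d := t - (a + b).
have qd : q * d = 0.
  rewrite mulrBr mulrDr qt (corner_compl_l pq ca) (corner_compl_l pq cb).
  by rewrite addr0 subr0.
have pd : p * d = d by rewrite -[RHS]mul1r -(compl_sum pq) mulrDl qd addr0.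
apply/eqP; rewrite -subr_eq0; apply/eqP/q_faithful => x; rewrite -/d.
pose c := q * x * p.
have cc : corner q p c.
  by split; rewrite ?mulrA ?(compl_idem qp) // -mulrA (compl_idem pq).
have csc := corner_star sq sp cc.
have oc z : corner p p z -> off_diagonal p (star_jordan c z).
  move=> [pz zp]; apply: offD.
    apply/(off_compl qp)/(corner_off qp); split; last by rewrite -mulrA zp.
    by rewrite mulrA; case: cc => ->.
  apply: (corner_off pq); split; first by rewrite mulrA pz.
  by rewrite -mulrA; case: csc => _ ->.
have : star_jordan c t = star_jordan c a + star_jordan c b.
  apply: (additive_transfer_r te); apply: (additive_off pq).
    exact: off_half (oc _ ca).
  exact: off_half (oc _ cb).
rewrite -star_jordanDr => /eqP; rewrite -subr_eq0.
have -> : star_jordan c t - star_jordan c (a + b) = star_jordan c d.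
  by rewrite /star_jordan /d mulrBr mulrBl opprD addrACA.
move=> /eqP /(congr1 ( *%R q)).
rewrite mulr0 mulrDr !mulrA qd mul0r addr0 (compl_idem qp).
by rewrite -[_ * p * d]mulrA pd.
Qed.

Theorem star_jordan_map_additive p q : complementary p q ->
    (forall d : A, (forall x, p * x * d = 0) -> d = 0) ->
    (forall d : A, (forall x, q * x * d = 0) -> d = 0) ->
  {morph phi : x y / x + y}.
Proof.
move=> pq p_faithful q_faithful x y; have qp := complementaryC pq.
have [pp qq] := (compl_idem pq, compl_idem qp).
have cor e f z : e * e = e -> f * f = f -> corner e f (e * z * f).
  by move=> ee ff; split; rewrite ?mulrA ?ee // -mulrA ff.
have oz z : off_diagonal p (p * z * q + q * z * p).
  apply: offD; first by apply: (corner_off pq); apply: cor.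
  by apply/(off_compl qp)/(corner_off qp); apply: cor.
have phi_split z :=
  additive_peirce pq (cor _ _ z pp pp) (oz z) (cor _ _ z qq qq).
rewrite [x in RHS](peirce_decomposition x pq).
rewrite [y in RHS](peirce_decomposition y pq).
rewrite [x + y](peirce_decomposition _ pq) !phi_split.
rewrite !(mulrDr p) !(mulrDr q) !(mulrDl _ _ p) !(mulrDl _ _ q).
rewrite (additive_diag pq q_faithful (cor _ _ x pp pp) (cor _ _ y pp pp)).
rewrite (additive_diag qp p_faithful (cor _ _ x qq qq) (cor _ _ y qq qq)).
rewrite [_ + (q * x * p + _)]addrACA (additive_off pq (oz x) (oz y)).
by rewrite [X in X + _ = _]addrACA [LHS]addrACA.
Qed.

End Additivity.

(** * Multiplicativity *)

Section Multiplicativity.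
Variables (A B : starRingType) (i : A) (phi : A -> B).
Hypothesis i2 : i * i = -1.
Hypothesis i_central : forall x, i * x = x * i.
Hypothesis star_i : star i = - i.
Hypothesis double0 : forall x : B, x *+ 2 = 0 -> x = 0.
Hypothesis phi_bij : bijective phi.
Hypothesis phi1 : phi 1 = 1.
Hypothesis phiD : {morph phi : x y / x + y}.
Hypothesis phiJ : forall x y : A,
  phi (star_jordan x y) = star_jordan (phi x) (phi y).
Implicit Types x y z s t : A.

Let double_injB := double0_inj double0.

Lemma additive0 : phi 0 = 0.
Proof. by apply: (@addrI _ (phi 0)); rewrite -phiD !addr0. Qed.

Lemma additiveN x : phi (- x) = - phi x.
Proof. by apply: (@addrI _ (phi x)); rewrite -phiD !subrr additive0. Qed.

Lemma star_jordan_map_star x : phi (star x) = star (phi x).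
Proof.
have := phiJ x 1; rewrite phi1 /star_jordan !mulr1 !mul1r phiD; exact: addrI.
Qed.

Let J := phi i.

Lemma phi_sa s : star s = s -> star (phi s) = phi s.
Proof. by move=> ss; rewrite -star_jordan_map_star ss. Qed.

Lemma phi_jordan s x : star s = s ->
  phi (s * x + x * s) = phi s * phi x + phi x * phi s.
Proof. by move=> ss; rewrite -!star_jordan_sa ?phi_sa// phiJ. Qed.

Lemma phi_i_star : star J = - J.
Proof. by rewrite -star_jordan_map_star star_i additiveN. Qed.

(** Because [{i, x} = 0] for all [x]. *)
Lemma phi_i_central b : J * b = b * J.
Proof.
have [x <-] := phi_preim phi_bij b.
apply/eqP; rewrite -subr_eq0 -mulrN -phi_i_star; apply/eqP.
have := phiJ i x; rewrite /star_jordan star_i mulrN i_central subrr additive0.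
by move=> <-.
Qed.

(** Because [{s, i} = 2 i s] for self-adjoint [s]. *)
Lemma phi_i_sa s : star s = s -> phi (i * s) = J * phi s.
Proof.
move=> ss; have := phiJ s i; rewrite /star_jordan (phi_sa ss) ss -i_central.
by rewrite -phi_i_central -!mulr2n mulr2n phiD -mulr2n => /double_injB.
Qed.

(** Because [{i s, x} = i [s, x]] for self-adjoint [s]. *)
Lemma phi_i_commutator s x : star s = s ->
  phi (i * (s * x - x * s)) = J * (phi s * phi x - phi x * phi s).
Proof.
move=> ss; have := phiJ (i * s) x; rewrite /star_jordan phi_i_sa//.
rewrite !starM ss (phi_sa ss) star_i phi_i_star !mulrN.
rewrite -(i_central s) -(phi_i_central (phi s)).
rewrite !mulrBr !mulrA -(i_central x) -(phi_i_central (phi x)) => <-.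
by rewrite -[i * s * x]mulrA.
Qed.

(** With [u = i [p, t]], self-adjoint, [i [p, u] = - t] in [A], while the
    same computation in [B] replaces [i] by [J]. *)
Lemma phi_i_sqr_off p t : projection p -> star t = t -> off_diagonal p t ->
  (J * J + 1) * phi t = 0.
Proof.
move=> [sp pp] st ot.
pose u := i * (p * t - t * p).
have su : star u = u.
  by rewrite starM starB !starM sp st star_i mulrN -i_central -mulrN opprB.
have Pp : phi p * phi p = phi p.
  by apply: double_injB; rewrite mulr2n -phi_jordan// pp phiD.
have ophi : off_diagonal (phi p) (phi t).
  by rewrite /off_diagonal -phi_jordan// ot.
have uE : i * (p * u - u * p) = - t.
  rewrite /u mulrA -i_central -!mulrA -mulrBr double_commutator_off//.
  by rewrite mulrA i2 mulN1r.
have := phi_i_commutator u sp; rewrite uE additiveN (phi_i_commutator t sp).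
rewrite mulrA -phi_i_central -!mulrA -mulrBr double_commutator_off// => e.
by rewrite mulrDl mul1r -mulrA -e addNr.
Qed.

Hypothesis B_prime : prime_ring B.
Variables p t : A.
Hypothesis p_proj : projection p.
Hypothesis t_sa : star t = t.
Hypothesis t_off : off_diagonal p t.
Hypothesis t_neq0 : t <> 0.

(** The element [J * J + 1] is central and kills [phi t], which is not zero. *)
Lemma phi_i_sqr : J * J = -1.
Proof.
have [x||pt0] := B_prime (a := J * J + 1) (b := phi t).
- have JJ_central : (J * J + 1) * x = x * (J * J + 1).
    rewrite mulrDl mulrDr mul1r mulr1 -mulrA (phi_i_central x).
    by rewrite mulrA (phi_i_central x) mulrA.
  by rewrite JJ_central -mulrA (phi_i_sqr_off p_proj t_sa t_off) mulr0.
- by move/eqP; rewrite addr_eq0 => /eqP.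
- by case: t_neq0; apply: (bij_inj phi_bij); rewrite additive0.
Qed.

(** Twice the decomposition into real and imaginary parts. *)
Lemma cartesian z : exists a b,
  [/\ star a = a, star b = b & z *+ 2 = a + i * b].
Proof.
exists (z + star z), (- (i * (z - star z))); split.
- by rewrite starD starK addrC.
- by rewrite starN starM starB starK star_i mulrN -i_central -mulrN opprB.
- by rewrite mulrN mulrA i2 mulN1r opprK addrACA subrr addr0 -mulr2n.
Qed.

(** For [z = a + i b] this reads [phi (i a - b) = J phi a - phi b], which agrees
    with [J (phi a + J phi b)] exactly because [J ^ 2 = -1]. *)
Lemma phi_i_mul z : phi (i * z) = J * phi z.
Proof.
have [a [b [sa sb zE]]] := cartesian z.
apply: double_injB; rewrite -mulrnAr !mulr2n -!phiD -mulrDr -mulr2n zE.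
rewrite mulrDr mulrA i2 mulN1r !phiD !phi_i_sa// additiveN.
by rewrite mulrDr mulrA phi_i_sqr mulN1r.
Qed.

(** The sum of the Jordan product and of the commutator. *)
Lemma phi_mul_sa s x : star s = s -> phi (s * x) = phi s * phi x.
Proof.
move=> ss; apply: double_injB.
have com : phi (s * x - x * s) = phi s * phi x - phi x * phi s.
  have := phi_i_commutator x ss; rewrite phi_i_mul => /(congr1 ( *%R J)).
  by rewrite !mulrA phi_i_sqr !mulN1r => /oppr_inj.
have : phi ((s * x + x * s) + (s * x - x * s)) =
    (phi s * phi x + phi x * phi s) + (phi s * phi x - phi x * phi s).
  by rewrite phiD phi_jordan// com.
by rewrite addrACA [RHS]addrACA !subrr !addr0 phiD -!mulr2n.
Qed.

Lemma star_jordan_map_mul : {morph phi : x y / x * y}.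
Proof.
move=> x y; have [a [b [sa sb xE]]] := cartesian x.
apply: double_injB; rewrite -mulrnAl !mulr2n -!phiD -mulrDl -mulr2n xE.
rewrite mulrDl -mulrA !phiD !phi_i_mul (phi_mul_sa _ sa) (phi_mul_sa _ sb).
by rewrite mulrDl mulrA.
Qed.

End Multiplicativity.

(** * From the n-fold product to isomorphisms *)

Lemma star_jordan_n_map (A B : starRingType) (phi : A -> B) (s : seq A) :
  star_ring_isomorphism phi ->
  phi (star_jordan_n s) = star_jordan_n (map phi s).
Proof.
case=> _ phiD phiM phiS; case: s => [|x s] /=.
  by apply: (@addrI _ (phi 0)); rewrite -phiD !addr0.
elim: s x => //= y s IHs x; rewrite IHs /star_jordan.
by rewrite phiD !phiM phiS.
Qed.

Lemma star_ring_isomorphism1 (A B : starRingType) (phi : A -> B) :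
  star_ring_isomorphism phi -> phi 1 = 1.
Proof.
case=> [[g _ gK] _ phiM _].
by rewrite -[LHS]mulr1 -[X in _ * X]gK -phiM mul1r gK.
Qed.

(** With [m = n - 2] leading ones, and then once more with [x = 1], the factors
    [2 ^ m] and [2 ^ m.+1] appear; the half absorbs their quotient, so that no
    homogeneity of [phi] is needed. *)
Lemma multiplicative_star_jordan2 (A B : starRingType) (half : A)
    (phi : A -> B) (n : nat) : (2 <= n)%N -> half *+ 2 = 1 ->
    (forall x : B, x *+ 2 = 0 -> x = 0) ->
    phi 1 = 1 -> multiplicative_star_jordan n phi ->
  forall x y, phi (half * star_jordan x y) *+ 2 = star_jordan (phi x) (phi y).
Proof.
move=> n2 half2 double0 phi1 phiJ.
pose m := (n - 2)%N.
have sz x y : size (nseq m 1 ++ [:: x; y] : seq A) == n.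
  by rewrite size_cat size_nseq /= subnK.
have phiJ2 x y : phi (star_jordan x y *+ 2 ^ m) =
    star_jordan (phi x) (phi y) *+ 2 ^ m.
  have := phiJ (Tuple (sz x y)).
  by rewrite /= map_cat map_nseq /= phi1 !star_jordan_n_nseq1.
have pow2_inj : forall k (x y : B), x *+ 2 ^ k = y *+ 2 ^ k -> x = y.
  elim=> [|k IHk] x y; first by rewrite !mulr1n.
  by rewrite expnSr !mulrnA => /(double0_inj double0) /IHk.
move=> x y; apply: (pow2_inj m).
have := phiJ2 1 (half * star_jordan x y).
by rewrite phi1 !star_jordan1l double_half// phiJ2.
Qed.

(** Primeness gives a nonzero [c] in [p A q]; then [c + star c] is not zero
    because its two terms lie in different corners. *)
Lemma prime_off_diagonal (A : starRingType) (p q : A) :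
  prime_ring A -> complementary p q -> p <> 0 -> q <> 0 ->
  exists t, [/\ star t = t, off_diagonal p t & t <> 0].
Proof.
move=> primeA pq p0 q0; have qp := complementaryC pq.
have [sp sq] := (compl_star pq, compl_star qp).
have [x pxq0] : exists x, p * x * q <> 0.
  apply: contrapT => /forallNP pxq.
  by case: (primeA p q) => [x|//|//]; apply: contrapT; apply: pxq.
pose c := p * x * q.
have cc : corner p q c.
  by split; rewrite ?mulrA ?(compl_idem pq) // -mulrA (compl_idem qp).
have csc := corner_star sp sq cc.
exists (c + star c); split.
- by rewrite starD starK addrC.
- by apply: offD; [apply: (corner_off pq)|apply/(off_compl qp)/(corner_off qp)].
- move=> e; apply: pxq0; apply: (corner_sa_inj pq cc).
    by split; rewrite ?mulr0 ?mul0r.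
  by rewrite e star0 addr0.
Qed.

(** The purely algebraic form, where the scalars [1 / 2] and [i] are elements
    of the ring. *)
Theorem star_jordan_map_isomorphism (A B : starRingType) (half i p q : A)
    (n : nat) (phi : A -> B) : (2 <= n)%N ->
    half *+ 2 = 1 -> (forall x : B, x *+ 2 = 0 -> x = 0) ->
    i * i = -1 -> (forall x, i * x = x * i) -> star i = - i ->
    prime_ring A -> prime_ring B ->
    complementary p q -> p <> 0 -> q <> 0 ->
    bijective phi -> phi 1 = 1 -> multiplicative_star_jordan n phi ->
  star_ring_isomorphism phi.
Proof.
move=> n2 half2 double0 i2 i_central star_i primeA primeB pq p0 q0.
move=> phi_bij phi1 phiJn.
have phiJh := multiplicative_star_jordan2 n2 half2 double0 phi1 phiJn.
have faithful e : e <> 0 -> forall d : A, (forall x, e * x * d = 0) -> d = 0.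
  by move=> e0 d /primeA [].
have phiD := star_jordan_map_additive half2 double0 phi_bij phiJh pq
  (faithful p p0) (faithful q q0).
have phiJ x y : phi (star_jordan x y) = star_jordan (phi x) (phi y).
  by rewrite -phiJh mulr2n -phiD -mulr2n double_half.
have [t [st ot t0]] := prime_off_diagonal primeA pq p0 q0.
have [pproj _] := pq.
split=> //.
  exact: (star_jordan_map_mul i2 i_central star_i double0 phi_bij phi1 phiD phiJ
    primeB pproj st ot t0).
exact: star_jordan_map_star phi1 phiD phiJ.
Qed.

Theorem corollary3p2 (R : realType) (n : nat) (hn : (2 <= n)%N)
    (A A' : cstarAlgType R) (hA : prime_ring A) (hA' : prime_ring A')
    (P1 P2 : A) (hP2 : P2 = 1 - P1)
    (hP1_proj : nontrivial_projection P1)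
    (hP2_proj : nontrivial_projection P2)
    (phi : A -> A') :
  [/\ bijective phi, phi 1 = 1 & multiplicative_star_jordan n phi]
  <-> star_ring_isomorphism phi.
Proof.
split=> [[phi_bij phi1 phiJ]|iso]; last first.
  split; [by case: iso | exact: star_ring_isomorphism1 |].
  by move=> x; apply: star_jordan_n_map.
have two_neq0 : 2 != 0 :> complex R by rewrite pnatr_eq0.
case: hP1_proj => P1_proj P1_neq0 _; case: hP2_proj => _ P2_neq0 _.
apply: (@star_jordan_map_isomorphism A A' (2^-1)%:A ('i%C)%:A P1 P2 n) => //.
- by rewrite -[LHS]scaler_nat scalerA mulfV// scale1r.
- move=> x /(congr1 (fun y => 2^-1 *: y)).
  by rewrite scaler0 -[x *+ 2]scaler_nat scalerA mulVf// scale1r.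
- by rewrite -scalerAl mul1r scalerA -expr2 sqr_i scaleN1r.
- by move=> x; rewrite -scalerAl -scalerAr mul1r mulr1.
- rewrite starZ star1 -scaleNr; congr (_ *: _).
  by apply/eqP; rewrite eq_complex /= oppr0 !eqxx.
Qed.
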